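(* Let $\Delta t=\Delta s^{1/4}$ and set $m=\lfloor T/\Delta t\rfloor$. Then for all $T>0$ and for all $S>0$, the acceptance probability $$\alpha(\boldsymbol{u},\boldsymbol{p})=\min\left(1,\,e^{-(\Delta s)\left(H(\boldsymbol{u}^m,\boldsymbol{p}^m)-H(\boldsymbol{u},\boldsymbol{p})\right)}\right)$$ of the Cayley-based Hamiltonian Monte Carlo algorithm with $m$ integration steps satisfies $$\lim_{\Delta s\to0}\mathrm{E}(\alpha)=1,$$ where $\mathrm{E}$ is the expected value over random $(\boldsymbol{u},\boldsymbol{p})\in\mathbb{R}^{2(n-1)}$ with non-normalized density $e^{-(\Delta s)H(\boldsymbol{u},\boldsymbol{p})}$.
   Context: Let $S>0$, let $n\ge2$ be an integer and let $\Delta s = S/n$ (spatial step size; $\Delta s\to0$ means $n\to\infty$ with $S$ fixed); $\Delta t>0$ is the time step size. $\boldsymbol{L}$ is the $(n-1)\times(n-1)$ discrete Dirichlet Laplacian: the symmetric tridiagonal matrix with diagonal entries $-2/\Delta s^2$ and entries $1/\Delta s^2$ on the first sub- and superdiagonal. The Hamiltonian is $$H(\boldsymbol{u},\boldsymbol{p})=\tfrac12\|\boldsymbol{p}\|^2-\tfrac12\boldsymbol{u}^{\mathrm T}\boldsymbol{L}\boldsymbol{u}+\tfrac12\|\boldsymbol{u}\|^2,\qquad \boldsymbol{u},\boldsymbol{p}\in\mathbb{R}^{n-1}.$$ With $\boldsymbol{I}$ the identity matrix, define $$\boldsymbol{A} = \begin{bmatrix} \boldsymbol{0} & \boldsymbol{I}\\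 \boldsymbol{L} & \boldsymbol{0}\end{bmatrix},\qquad \boldsymbol{B}=\begin{bmatrix}\boldsymbol{0}&\boldsymbol{0}\\-\boldsymbol{I}&\boldsymbol{0}\end{bmatrix},\qquad \boldsymbol{C} = \exp\left(\tfrac12 \Delta t\, \boldsymbol{B}\right)\mathrm{cay}(\Delta t\, \boldsymbol{A})\exp\left(\tfrac12 \Delta t\, \boldsymbol{B}\right),$$ where $\mathrm{cay}(\boldsymbol{X})=(\boldsymbol{I}-\frac12\boldsymbol{X})^{-1}(\boldsymbol{I}+\frac12\boldsymbol{X})$ is the Cayley transform and $\exp$ the matrix exponential. The proposal $(\boldsymbol{u}^m,\boldsymbol{p}^m)$ is defined by $\begin{bmatrix}\boldsymbol{u}^m\\ \boldsymbol{p}^m\end{bmatrix}=\boldsymbol{C}^m\begin{bmatrix}\boldsymbol{u}\\ \boldsymbol{p}\end{bmatrix}$. The HMC algorithm accepts the proposed position $\boldsymbol{u}^m$ with probability $\alpha(\boldsymbol{u},\boldsymbol{p})$ and otherwise keeps $\boldsymbol{u}$. *)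

(* Defs.v *)
From HB Require Import structures.
From mathcomp Require Import all_boot all_order all_algebra.
From mathcomp Require Import all_classical all_reals all_analysis.

Set Implicit Arguments.
Unset Strict Implicit.
Unset Printing Implicit Defensive.
Import Order.TTheory GRing.Theory Num.Theory.
Import numFieldNormedType.Exports.

Local Open Scope classical_set_scope.
Local Open Scope ring_scope.

Section lebesgue_measure_tuple.
Context {R : realType}.
Notation vec k := (k.-tuple (measurableTypeR R)).

Definition tcons k (x : measurableTypeR R * vec k) : vec k.+1 :=
  [tuple of x.1 :: x.2].

(* Lebesgue measure on R^k, as the k-fold product of [lebesgue_measure];
   R^0 is a point of mass 1. *)
Fixpoint lebesgue_tuple k : set (vec k) -> \bar R :=
  if k is k'.+1 then
    pushforward (@lebesgue_measure R \x @lebesgue_tuple k')%E (@tcons k')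
  else dirac ([tuple] : vec 0).

Lemma measurable_tcons k : measurable_fun [set: _] (@tcons k).
Proof. exact: (measurable_cons measurable_fst measurable_snd). Qed.

Lemma tcons_bij k : bijective (@tcons k).
Proof.
exists (fun t : vec k.+1 => (thead t, [tuple of behead t])).
  by case=> a t; congr pair; apply: val_inj.
by move=> t; rewrite [RHS]tuple_eta; apply: val_inj.
Qed.

Lemma measurable_image_tcons k (A : set (measurableTypeR R * vec k)) :
  measurable A -> measurable (@tcons k @` A).
Proof.
move=> mA; pose g (t : vec k.+1) := (thead t, [tuple of behead t]) : _ * vec k.
have gK : cancel g (@tcons k).
  by move=> t; rewrite [RHS]tuple_eta; apply: val_inj.
have tK : cancel (@tcons k) g by case=> a t; congr pair; apply: val_inj.
have -> : @tcons k @` A = g @^-1` A.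
  apply/seteqP; split => [_ [x Ax <-]|t At]; first by rewrite /preimage/= tK.
  by exists (g t).
have mg : measurable_fun [set: vec k.+1] g.
  by apply: measurable_fun_pair; [exact: measurable_tnth|exact: measurable_behead].
by rewrite -[X in measurable X]setTI; exact: mg.
Qed.

Section product_step.
Variables (k : nat) (nu : {sigma_finite_measure set (vec k) -> \bar R}).

Let step := pushforward (@lebesgue_measure R \x nu)%E (@tcons k).

Let step0 : step set0 = 0%E.
Proof. by rewrite /step /pushforward preimage_set0 measure0. Qed.

Let step_ge0 A : (0 <= step A)%E. Proof. exact: (measure_ge0 (@lebesgue_measure R \x nu)%E). Qed.

Let step_sigma_additive : semi_sigma_additive step.
Proof.
move=> F mF tF mUF; rewrite /step /pushforward preimage_bigcup.
have mpre (A : set (vec k.+1)) : measurable A -> measurable (@tcons k @^-1` A).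
  by move=> mA; rewrite -[X in measurable X]setTI; exact: measurable_tcons.
apply: measure_semi_sigma_additive.
- by move=> n; exact: mpre.
- apply/trivIsetP => i j _ _ ij; rewrite -preimage_setI.
  by move/trivIsetP : tF => /(_ _ _ I I ij) ->; rewrite preimage_set0.
- by rewrite -preimage_bigcup; exact: mpre.
Qed.

#[local] HB.instance Definition _ := isMeasure.Build _ _ _ step
  step0 step_ge0 step_sigma_additive.

Let step_sigma_finite : sigma_finite setT step.
Proof.
have /sigma_finiteP[F [FT Fnd Foo]] := sigma_finiteT (@lebesgue_measure R).
have /sigma_finiteP[G [GT Gnd Goo]] := sigma_finiteT nu.
exists (fun i => @tcons k @` (F i `*` G i)).
  apply/esym/seteqP; split => // t _.
  have [g _ gK] := tcons_bij k.
  have [i _ Fi] : (\bigcup_i F i) (g t).1 by rewrite -FT.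
  have [j _ Gj] : (\bigcup_i G i) (g t).2 by rewrite -GT.
  exists (maxn i j) => //; exists (g t) => //; split.
    by have /subsetPset := Fnd _ _ (leq_maxl i j); exact.
  by have /subsetPset := Gnd _ _ (leq_maxr i j); exact.
move=> i; have [mF Fi] := Foo i; have [mG Gi] := Goo i.
split; first by apply: measurable_image_tcons; exact: measurableX.
rewrite /step /pushforward.
have -> : @tcons k @^-1` (@tcons k @` (F i `*` G i)) = F i `*` G i.
  apply/seteqP; split => [x [y FGy]|x FGx]; last by exists x.
  by move=> /(bij_inj (tcons_bij k)) <-.
by rewrite product_measure1E//; apply: lte_mul_pinfty; rewrite ?ge0_fin_numE.
Qed.

#[local] HB.instance Definition _ := Measure_isSigmaFinite.Build _ _ _ step
  step_sigma_finite.

Lemma product_stepE : exists mu : {sigma_finite_measure set (vec k.+1) -> \bar R},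
  mu = pushforward (@lebesgue_measure R \x nu)%E (@tcons k)
    :> (set (vec k.+1) -> \bar R).
Proof. by exists step. Qed.

End product_step.

Lemma lebesgue_tuple_sigma_finite_measure k :
  exists mu : {sigma_finite_measure set (vec k) -> \bar R},
    mu = @lebesgue_tuple k :> (set (vec k) -> \bar R).
Proof.
elim: k => [|k [nu nuE]] /=; first by exists (dirac ([tuple] : vec 0)).
by rewrite -nuE; exact: product_stepE.
Qed.

Let lebesgue_tuple0 k : @lebesgue_tuple k set0 = 0%E.
Proof. by have [mu <-] := lebesgue_tuple_sigma_finite_measure k. Qed.

Let lebesgue_tuple_ge0 k A : (0 <= @lebesgue_tuple k A)%E.
Proof. by have [mu <-] := lebesgue_tuple_sigma_finite_measure k. Qed.

Let lebesgue_tuple_sigma_additive k : semi_sigma_additive (@lebesgue_tuple k).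
Proof.
have [mu <-] := lebesgue_tuple_sigma_finite_measure k.
exact: measure_semi_sigma_additive.
Qed.

HB.instance Definition _ k := isMeasure.Build _ _ _ (@lebesgue_tuple k)
  (lebesgue_tuple0 k) (@lebesgue_tuple_ge0 k) (@lebesgue_tuple_sigma_additive k).

Let lebesgue_tuple_sigma_finite k : sigma_finite setT (@lebesgue_tuple k).
Proof. by have [mu <-] := lebesgue_tuple_sigma_finite_measure k; exact: sigma_finiteT. Qed.

HB.instance Definition _ k := Measure_isSigmaFinite.Build _ _ _
  (@lebesgue_tuple k) (@lebesgue_tuple_sigma_finite k).

End lebesgue_measure_tuple.
Arguments lebesgue_tuple {R} k _.

Section cayley_hmc.
Context {R : realType}.

Definition expmx k (X : 'M[R]_k) : 'M[R]_k :=
  limn (series (fun i => (i`!%:R)^-1 *: X ^+ i)).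

Definition caymx k (X : 'M[R]_k) : 'M[R]_k :=
  invmx (1%:M - 2^-1 *: X) *m (1%:M + 2^-1 *: X).

(* Squared Euclidean norm; the library norm on matrices is the sup norm. *)
Definition sqnorm2 k (x : 'cV[R]_k) : R := \sum_i x i 0 ^+ 2.

(* Throughout, N is the number n - 1 of interior grid points, and phase space
   is R^(N + N), a vector [col_mx u p] having position u and momentum p. *)

Definition laplacian N (ds : R) : 'M[R]_N :=
  \matrix_(i, j) if i == j then - 2 / ds ^+ 2
    else if (i.+1 == j :> nat) || (j.+1 == i :> nat) then 1 / ds ^+ 2
    else 0.

Definition hamiltonian N (ds : R) (u p : 'cV[R]_N) : R :=
  2^-1 * sqnorm2 p - 2^-1 * (u^T *m laplacian N ds *m u) 0 0
  + 2^-1 * sqnorm2 u.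

Definition matA N (ds : R) : 'M[R]_(N + N) :=
  block_mx 0 1%:M (laplacian N ds) 0.

Definition matB N : 'M[R]_(N + N) := block_mx 0 0 (- 1%:M) 0.

Definition matC N (ds dt : R) : 'M[R]_(N + N) :=
  expmx ((2^-1 * dt) *: matB N) *m caymx (dt *: matA N ds)
    *m expmx ((2^-1 * dt) *: matB N).

Definition proposal N (ds dt : R) (m : nat) (u p : 'cV[R]_N) : 'cV[R]_(N + N) :=
  matC N ds dt ^+ m *m col_mx u p.

Definition acceptance N (ds dt : R) (m : nat) (u p : 'cV[R]_N) : R :=
  let um := usubmx (proposal ds dt m u p) in
  let pm := dsubmx (proposal ds dt m u p) in
  Num.min 1 (expR (- (ds * (hamiltonian ds um pm - hamiltonian ds u p)))).

Definition gibbs_weight N (ds : R) (u p : 'cV[R]_N) : R :=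
  expR (- (ds * hamiltonian ds u p)).

Definition phase_integral N (f : 'cV[R]_N -> 'cV[R]_N -> R) : R :=
  \int[@lebesgue_tuple R (N + N)]_(t in setT)
    let z : 'cV[R]_(N + N) := \col_i tnth t i in f (usubmx z) (dsubmx z).

Definition gibbs_expectation N (ds : R) (f : 'cV[R]_N -> 'cV[R]_N -> R) : R :=
  phase_integral (fun u p => f u p * gibbs_weight ds u p)
  / phase_integral (fun u p => gibbs_weight (N := N) ds u p).

End cayley_hmc.

(* Main.v *)
Require Import Defs.
From HB Require Import structures.
From mathcomp Require Import all_boot all_order all_algebra.
From mathcomp Require Import all_classical all_reals all_analysis.
From mathcomp Require Import measurable_realfun ring lra.
Set Implicit Arguments.
Unset Strict Implicit.
Unset Printing Implicit Defensive.

Import Order.TTheory GRing.Theory Num.Theory.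
Import numFieldNormedType.Exports.
Local Open Scope classical_set_scope.
Local Open Scope ring_scope.

(** Write h for the time step, so h ^ 4 = ds, put N = n - 1 and G = I - L. The
    Gibbs weight is the Gaussian exp(- z^T M z / 2) with precision matrix
    M = ds * diag(G, I), and the weight of the proposal C^m z is the Gaussian
    whose precision matrix is M' = (C^m)^T M C^m. Since min(1, y) times the
    weight of z is the minimum of these two Gaussians, E(alpha) is the overlap
    of two centred Gaussians of equal mass (C preserves volume), and it tends to
    1 as soon as their Hellinger affinity
      sqrt (det M / det ((M + M') / 2))
    does. This turns the whole probabilistic statement into a determinant.

    The determinant is computed mode by mode. The vectors
    sin (i (j + 1) pi / n) diagonalise L with eigenvalues - lam_j, and in the
    mode j the integrator is a 2 x 2 matrix [a, b; - w b, a] with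
    w = (1 - h ^ 2 / 4) (1 + lam_j) and a ^ 2 + w b ^ 2 = 1. It is a rotation
    by an angle phi_j for the modified energy p ^ 2 + w q ^ 2: compared with the
    true energy p ^ 2 + (1 + lam_j) q ^ 2, the potential part is scaled by the
    same factor 1 - h ^ 2 / 4 in all modes. Hence (det_midpoint)
      det ((M + M') / 2) / det M = prod_j (1 + eta sin ^ 2 (m phi_j)),
    with eta of order h ^ 4.

    As there are about S / h ^ 4 modes, bounding the sines by 1 only gives a
    factor of order 1. What saves the day is that high frequencies are turned
    by almost pi in each step: sin phi_j is at most 4 / (h sqrt (1 + lam_j)),
    and over m <= T / h steps this leaves
      sin ^ 2 (m phi_j) <= min (1, A ^ 2 / (j + 1) ^ 2), A = 8 T S / h ^ 2,
    because lam_j grows at least like (j + 1) ^ 2 / (2 S) ^ 2. The sum over j is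
    at most 2 A + 1, of order h ^ -2, so the affinity is 1 - O(h ^ 2) and
    E(alpha) is 1 - O(h).

    The three Gaussian integrals that occur are computed by completing the
    square in one coordinate at a time (gaussian_integral), so no linear change
    of variables in R^k is involved. *)

(** * Gaussian integrals *)

Definition qform {R : realType} k (P : 'M[R]_k) (x : 'cV[R]_k) : R :=
  (x^T *m P *m x) 0 0.

Definition posdef {R : realType} k (P : 'M[R]_k) : Prop :=
  P^T = P /\ forall x : 'cV[R]_k, x != 0 -> 0 < qform P x.

Definition col_of_tuple {R : realType} k (t : k.-tuple R) : 'cV[R]_k :=
  \col_i tnth t i.

Definition gauss {R : realType} k (P : 'M[R]_k) (x : 'cV[R]_k) : R :=
  expR (- (2^-1 * qform P x)).

Section gaussian_integral.
Context {R : realType}.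

Lemma qformE k (P : 'M[R]_k) x : qform P x = \sum_i \sum_j P i j * x i 0 * x j 0.
Proof.
rewrite /qform mxE exchange_big /=; apply: eq_bigr => j _.
rewrite mxE mulr_suml; apply: eq_bigr => i _; rewrite mxE; ring.
Qed.

Lemma measurable_gauss k (P : 'M[R]_k) :
  measurable_fun [set: k.-tuple (measurableTypeR R)]
    (fun t => gauss P (col_of_tuple t)).
Proof.
rewrite /gauss; apply: measurableT_comp => //.
apply: measurableT_comp => //; apply: measurable_funM => //.
under eq_fun => t do rewrite qformE.
apply: measurable_sum => i; apply: measurable_sum => j.
under eq_fun => t do rewrite !mxE.
apply: measurable_funM; last exact: measurable_tnth.
by apply: measurable_funM => //; exact: measurable_tnth.
Qed.

(** A rescaled normal density of mean - c and variance 1 / a. *)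
Lemma integral_gauss1 (a c : R) : 0 < a ->
  (\int[@lebesgue_measure R]_x (expR (- (2^-1 * (a * (x + c) ^+ 2))))%:E
    = (Num.sqrt ((2 * pi) / a))%:E)%E.
Proof.
move=> a0; set s := Num.sqrt a^-1.
have s2 : s ^+ 2 = a^-1 by rewrite sqr_sqrtr// invr_ge0 ltW.
have s0 : s != 0 by rewrite sqrtr_eq0 -ltNge invr_gt0.
have pk0 : 0 < normal_peak s by exact: normal_peak_gt0.
transitivity (\int[@lebesgue_measure R]_x
   ((normal_peak s)^-1%:E * (normal_pdf (- c) s x)%:E))%E.
  apply: eq_integral => x _; rewrite -EFinM normal_pdfE// mulKf ?gt_eqF//.
  rewrite /normal_fun opprK s2; congr (expR _)%:E.
  by rewrite -mulr_natr; field; rewrite ?gt_eqF.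
rewrite ge0_integralZl//; last 3 first.
- by apply/measurable_EFinP; exact: measurable_normal_pdf.
- by move=> x _; rewrite lee_fin normal_pdf_ge0.
- by rewrite lee_fin invr_ge0 ltW.
rewrite integral_normal_pdf mule1 /normal_peak invrK s2; congr (Num.sqrt _)%:E.
by rewrite -mulr_natl; ring.
Qed.

Lemma col_of_tuple_tcons k (x : R) (t : k.-tuple (measurableTypeR R)) :
  col_of_tuple (tcons (x, t)) = col_mx x%:M (col_of_tuple t) :> 'cV[R]_(1 + k).
Proof.
apply/colP => i; rewrite [LHS]mxE (tnth_nth 0) /=.
case: (splitP i) => [j|j] ij.
  have -> : i = lshift k j by apply: val_inj.
  by rewrite col_mxEu !mxE (ord1 j).
have -> : i = rshift 1 j by apply: val_inj.
by rewrite col_mxEd !mxE (tnth_nth 0).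
Qed.

(** Completing the square in the first coordinate: [Q] is the Schur complement
    of the corner entry [a]. This is the inductive step of the Gaussian
    integral, phrased so that the variable [x] occurs only in a square. *)
Lemma posdef_schur k (P : 'M[R]_(1 + k)) : posdef P ->
  exists a : R, exists b : 'cV[R]_k, exists Q : 'M[R]_k,
  [/\ 0 < a, posdef Q, \det P = a * \det Q &
    forall x y, qform P (col_mx x%:M y) =
      a * (x + (b^T *m y) 0 0) ^+ 2 + qform Q y].
Proof.
move=> [Psym Ppos]; set a := ulsubmx P 0 0; set b := dlsubmx P; set D := drsubmx P.
have PE : P = block_mx a%:M b^T b D.
  have aE : ulsubmx P = a%:M by rewrite [LHS]mx11_scalar.
  have bE : ursubmx P = b^T by rewrite /b trmx_dlsub Psym.
  by rewrite -aE -bE submxK.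
have DT : D^T = D by rewrite /D trmx_drsub Psym.
have qPE x y : qform P (col_mx x%:M y)
    = a * x ^+ 2 + 2 * x * (b^T *m y) 0 0 + qform D y.
  rewrite /qform PE tr_col_mx mul_row_block mul_row_col tr_scalar_mx.
  rewrite !mulmxDl !mul_scalar_mx.
  rewrite -!mulmxA !mul_mx_scalar.
  have -> : y^T *m (x *: b) = x *: (b^T *m y)^T.
    by rewrite trmx_mul trmxK -scalemxAr.
  rewrite mulmxA -scalemxAl !mxE eqxx !mulr1n; ring.
have a0 : 0 < a.
  have := Ppos (col_mx 1%:M 0); rewrite qPE mulmx0 mxE.
  have -> : qform D 0 = 0 by rewrite /qform mulmx0 mxE.
  rewrite mulr0 !addr0 expr1n mulr1; apply.
  apply/eqP => /(congr1 usubmx); rewrite col_mxKu linear0.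
  by move=> /matrixP/(_ 0 0)/eqP; rewrite !mxE eqxx oner_eq0.
have an0 : a != 0 by rewrite gt_eqF.
pose Q := D - a^-1 *: (b *m b^T).
have qQE y : qform Q y = qform D y - a^-1 * ((b^T *m y) 0 0) ^+ 2.
  rewrite /qform /Q mulmxBr mulmxBl [LHS]mxE [X in _ + X]mxE; congr (_ - _).
  rewrite -scalemxAr -scalemxAl [LHS]mxE; congr (_ * _).
  transitivity (((y^T *m b) *m (b^T *m y)) 0 0); first by rewrite !mulmxA.
  rewrite [LHS]mxE big_ord1 expr2; congr (_ * _).
  by rewrite -{1}[b]trmxK -trmx_mul [LHS]mxE.
exists a, (a^-1 *: b), Q; split=> //.
- split=> [|y y0].
    by rewrite /Q linearB /= DT linearZ /= trmx_mul trmxK.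
  (* the first coordinate that makes the square vanish *)
  have := Ppos (col_mx (- a^-1 * (b^T *m y) 0 0)%:M y).
  rewrite qPE qQE; set be := (b^T *m y) 0 0 => H.
  suff -> : qform D y - a^-1 * be ^+ 2 = a * (- a^-1 * be) ^+ 2 + 2 * (- a^-1 * be) * be + qform D y.
    apply: H; apply: contra_neq y0 => /(congr1 dsubmx).
    by rewrite col_mxKd linear0.
  by field.
- have -> : P = block_mx 1%:M 0 (a^-1 *: b) 1%:M *m block_mx a%:M b^T 0 Q.
    rewrite mulmx_block !mul1mx !mul0mx !addr0 mul_mx_scalar scalerA.
    by rewrite divff// scale1r {1}PE /Q -scalemxAl addrC subrK.
  by rewrite det_mulmx det_lblock det_ublock !det1 !mul1r det_scalar1.
- move=> x y; rewrite qPE qQE.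
  have -> : ((a^-1 *: b)^T *m y) 0 0 = a^-1 * (b^T *m y) 0 0.
    by rewrite linearZ /= -scalemxAl [LHS]mxE.
  by field.
Qed.

(** Induction on the dimension. Integrating the first coordinate contributes
    sqrt (2 pi / a) whatever the other coordinates are, because they only
    translate the one-dimensional Gaussian; the Schur complement remains. *)
Lemma gaussian_integral k (P : 'M[R]_k) : posdef P -> 0 < \det P /\
  (\int[lebesgue_tuple k]_t (gauss P (col_of_tuple t))%:E
    = (Num.sqrt ((2 * pi) ^+ k / \det P))%:E)%E.
Proof.
elim: k P => [|k IH] P Ppos.
  rewrite det_mx00 divr1 expr0 sqrtr1; split=> //.
  rewrite [LHS]integral_dirac//=.
    by rewrite diracT mul1e /gauss /qform !mxE big_ord0 mulr0 oppr0 expR0.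
  by apply/measurable_EFinP; exact: measurable_gauss.
have [a [b [Q [a0 /IH[detQ intQ] detP qP]]]] := posdef_schur Ppos.
split; first by rewrite detP mulr_gt0.
have mg : measurable_fun setT
   (fun z : measurableTypeR R * k.-tuple (measurableTypeR R) =>
     (gauss P (col_of_tuple (tcons z)))%:E).
  apply/measurable_EFinP.
  exact: (measurableT_comp (measurable_gauss P) (@measurable_tcons _ _)).
rewrite /= ge0_integral_pushforward//=; last 3 first.
- exact: measurable_tcons.
- by apply/measurable_EFinP; exact: measurable_gauss.
- by move=> t _; rewrite lee_fin expR_ge0.
rewrite preimage_setT [LHS]fubini_tonelli2//; last first.
  by move=> z; rewrite lee_fin expR_ge0.
rewrite /fubini_G.
transitivity (\int[lebesgue_tuple k]_t
  ((Num.sqrt ((2 * pi) / a))%:E * (gauss Q (col_of_tuple t))%:E))%E.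
  apply: eq_integral => t _ /=.
  rewrite -(integral_gauss1 ((b^T *m col_of_tuple t) 0 0) a0).
  rewrite -ge0_integralZr//; last 2 first.
  - apply/measurable_EFinP; apply: measurableT_comp => //.
    apply: measurableT_comp => //; apply: measurable_funM => //.
    apply: measurable_funM => //; apply: measurable_funX.
    exact: measurable_funD.
  - by rewrite lee_fin expR_ge0.
  apply: eq_integral => x _ /=; rewrite -EFinM -expRD /gauss; congr (expR _)%:E.
  by rewrite col_of_tuple_tcons qP; ring.
rewrite ge0_integralZl//; last 2 first.
- by apply/measurable_EFinP; exact: measurable_gauss.
- by move=> t _; rewrite lee_fin expR_ge0.
rewrite intQ -EFinM -sqrtrM; last by rewrite divr_ge0 ?mulr_ge0 ?pi_ge0// ltW.
congr (Num.sqrt _)%:E; rewrite detP exprS.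
by field; rewrite !gt_eqF.
Qed.

End gaussian_integral.

(** * Overlap of two Gaussians *)

Section overlap.
Context {R : realType}.

Lemma qform_mid k (P Q : 'M[R]_k) x :
  qform (2^-1 *: (P + Q)) x = 2^-1 * (qform P x + qform Q x).
Proof.
by rewrite /qform -scalemxAr -scalemxAl mulmxDr mulmxDl [LHS]mxE [X in _ * X]mxE.
Qed.

Lemma posdef_mid k (P Q : 'M[R]_k) :
  posdef P -> posdef Q -> posdef (2^-1 *: (P + Q)).
Proof.
move=> [PT Ppos] [QT Qpos]; split; first by rewrite linearZ linearD /= PT QT.
move=> x x0; by rewrite qform_mid mulr_gt0// addr_gt0//; [exact: Ppos|exact: Qpos].
Qed.

(** The geometric mean of two Gaussians is again a Gaussian: this is why the
    affinity of two Gaussian densities is a ratio of determinants. *)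
Lemma gauss_mid k (P Q : 'M[R]_k) x :
  gauss (2^-1 *: (P + Q)) x ^+ 2 = gauss P x * gauss Q x.
Proof.
rewrite /gauss expr2 -!expRD; congr expR.
rewrite qform_mid.
by field.
Qed.

(** From min(w, w') = (w + w' - |w - w'|) / 2, the factorisation
    |w - w'| = |sqrt w - sqrt w'| (sqrt w + sqrt w') and the inequality
    2 x y <= x ^ 2 / d + d y ^ 2. The lower bound is linear in w, w' and
    r = sqrt (w w'), so it can be integrated directly; this replaces the
    Cauchy-Schwarz inequality between total variation and affinity. *)
Lemma min_ge_overlap (w w' r d : R) : 0 < d -> 0 <= w -> 0 <= w' -> 0 <= r ->
  r ^+ 2 = w * w' ->
  (2^-1 - 4^-1 * (d^-1 + d)) * (w + w') + 2^-1 * (d^-1 - d) * r <= Num.min w w'.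
Proof.
move=> d0 w0 w'0 r0 rE.
wlog ww' : w w' w0 w'0 rE / w <= w' => [H|].
  have [ww'|/ltW w'w] := leP w w'; first by have := H w w'; rewrite min_l//; exact.
  move: (H w' w); rewrite min_l// [w' + w]addrC => Hw; apply: Hw => //.
  by rewrite mulrC.
rewrite min_l//.
set a := Num.sqrt w; set b := Num.sqrt w'.
have a2 : w = a ^+ 2 by rewrite sqr_sqrtr.
have b2 : w' = b ^+ 2 by rewrite sqr_sqrtr.
have rab : r = a * b.
  apply/eqP; rewrite -(eqrXn2 (n := 2))// ?mulr_ge0 ?sqrtr_ge0//.
  by rewrite rE exprMn -a2 -b2.
rewrite rab a2 b2 -subr_ge0.
suff -> : a ^+ 2 - ((2^-1 - 4^-1 * (d^-1 + d)) * (a ^+ 2 + b ^+ 2)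
    + 2^-1 * (d^-1 - d) * (a * b))
  = 4^-1 * d^-1 * ((b - a) - d * (a + b)) ^+ 2.
  by rewrite mulr_ge0 ?sqr_ge0// mulr_ge0// invr_ge0 ltW.
by field; rewrite gt_eqF.
Qed.

Lemma integrable_gauss k (P : 'M[R]_k) : posdef P ->
  (lebesgue_tuple k).-integrable setT (fun t => (gauss P (col_of_tuple t))%:E).
Proof.
move=> Ppos; apply/integrableP; split.
  by apply/measurable_EFinP; exact: measurable_gauss.
under eq_integral do rewrite gee0_abs ?lee_fin ?expR_ge0//.
by have [_ ->] := gaussian_integral Ppos; rewrite ltry.
Qed.

Lemma Rintegral_gauss k (P : 'M[R]_k) : posdef P ->
  \int[lebesgue_tuple k]_t gauss P (col_of_tuple t)
    = Num.sqrt ((2 * pi) ^+ k / \det P).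
Proof. by move=> Ppos; rewrite /Rintegral (gaussian_integral Ppos).2. Qed.

(** [rho] is a lower bound for the affinity of the two densities. The
    parameter [d] is free, and is to be chosen of order sqrt (1 - rho). *)
Lemma gaussian_overlap k (P Q : 'M[R]_k) (d rho : R) :
  posdef P -> posdef Q -> \det Q = \det P -> 0 < d ->
  rho <= Num.sqrt (\det P / \det (2^-1 *: (P + Q))) -> rho <= 1 -> d <= 1 ->
  1 - ((1 - rho) / (2 * d) + d)
  <= (\int[lebesgue_tuple k]_t
       Num.min (gauss P (col_of_tuple t)) (gauss Q (col_of_tuple t)))
     / (\int[lebesgue_tuple k]_t gauss P (col_of_tuple t)) <= 1.
Proof.
move=> Ppos Qpos detPQ d0 rhole rho1 d1.
have Mpos := posdef_mid Ppos Qpos.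
have [detP _] := gaussian_integral Ppos.
have [detM _] := gaussian_integral Mpos.
set M := 2^-1 *: (P + Q) in Mpos detM rhole.
set Z := (X in _ <= _ / X <= _).
have ZE : Z = Num.sqrt ((2 * pi) ^+ k / \det P) by exact: Rintegral_gauss.
have Z0 : 0 < Z.
  by rewrite ZE sqrtr_gt0 divr_gt0// exprn_gt0// mulr_gt0// pi_gt0.
have iP := integrable_gauss Ppos; have iQ := integrable_gauss Qpos.
have iM := integrable_gauss Mpos.
have imin : (lebesgue_tuple k).-integrable setT (fun t =>
    (Num.min (gauss P (col_of_tuple t)) (gauss Q (col_of_tuple t)))%:E).
  apply: le_integrable iP => //.
    by apply/measurable_EFinP; apply: measurable_minr; exact: measurable_gauss.
  move=> t _; rewrite !abse_EFin lee_fin !ger0_norm ?expR_ge0//.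
    by rewrite ge_min lexx.
  by rewrite le_min !expR_ge0.
rewrite ler_pdivrMr// mul1r ler_pdivlMr//; apply/andP; split; last first.
  by apply: le_Rintegral => // t _; rewrite ge_min lexx.
set c1 := 2^-1 - 4^-1 * (d^-1 + d).
set c2 := 2^-1 * (d^-1 - d).
have iPQ : (lebesgue_tuple k).-integrable setT (fun t =>
   ((gauss P (col_of_tuple t) + gauss Q (col_of_tuple t)))%:E).
  under eq_fun do rewrite EFinD.
  exact: integrableD.
have i1 : (lebesgue_tuple k).-integrable setT (fun t =>
   (c1 * (gauss P (col_of_tuple t) + gauss Q (col_of_tuple t)))%:E).
  under eq_fun do rewrite EFinM.
  exact: integrableZl.
have i2 : (lebesgue_tuple k).-integrable setT (fun t =>
   (c2 * gauss M (col_of_tuple t))%:E).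
  under eq_fun do rewrite EFinM.
  exact: integrableZl.
apply: (@le_trans _ _ (\int[lebesgue_tuple k]_t
  (c1 * (gauss P (col_of_tuple t) + gauss Q (col_of_tuple t))
   + c2 * gauss M (col_of_tuple t)))); last first.
  apply: le_Rintegral => //.
    exact: (integrableD measurableT i1 i2).
  move=> t _; apply: min_ge_overlap; rewrite ?expR_ge0//.
  exact: gauss_mid.
rewrite RintegralD// RintegralZl// RintegralZl// RintegralD//.
rewrite -/Z (Rintegral_gauss Qpos) detPQ -ZE (Rintegral_gauss Mpos).
set y := Num.sqrt _.
have yE : y = Z * Num.sqrt (\det P / \det M).
  rewrite ZE -sqrtrM; last by rewrite divr_ge0 ?exprn_ge0 ?mulr_ge0 ?pi_ge0// ltW.
  by congr Num.sqrt; field; rewrite !gt_eqF.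
have yge : Z * rho <= y by rewrite yE ler_pM2l.
have c20 : 0 <= c2.
  rewrite /c2 mulr_ge0// subr_ge0 (le_trans d1)//.
  by rewrite invf_ge1.
apply: (@le_trans _ _ (c1 * (Z + Z) + c2 * (Z * rho))); last first.
  by rewrite lerD2l ler_wpM2l.
rewrite -subr_ge0.
suff -> : c1 * (Z + Z) + c2 * (Z * rho) - (1 - ((1 - rho) / (2 * d) + d)) * Z
    = Z * (2^-1 * d * (1 - rho)).
  by rewrite mulr_ge0 ?(ltW Z0)// mulr_ge0 ?subr_ge0// mulr_ge0// ltW.
by rewrite /c1 /c2; field; rewrite gt_eqF.
Qed.

End overlap.

(** * Matrices with diagonal blocks *)

Section diagonal_blocks.
Context {R : realType} {N : nat}.
Implicit Types a b c d : 'I_N -> R.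

Definition dmx a : 'M[R]_N := diag_mx (\row_i a i).

(** A family of 2 x 2 matrices [a i, b i; c i, d i], one for each mode, acting
    on positions and momenta. *)
Definition dblk a b c d : 'M[R]_(N + N) :=
  block_mx (dmx a) (dmx b) (dmx c) (dmx d).

Lemma dmxM a b : dmx a *m dmx b = dmx (fun i => a i * b i).
Proof.
by rewrite /dmx mulmx_diag; congr diag_mx; apply/rowP => i; rewrite !mxE.
Qed.

Lemma dmxD a b : dmx a + dmx b = dmx (fun i => a i + b i).
Proof. by rewrite /dmx -linearD; congr diag_mx; apply/rowP => i; rewrite !mxE. Qed.

Lemma dmxZ (k : R) a : k *: dmx a = dmx (fun i => k * a i).
Proof. by rewrite /dmx -linearZ; congr diag_mx; apply/rowP => i; rewrite !mxE. Qed.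

Lemma dmx_cst (k : R) : dmx (fun=> k) = k%:M.
Proof. by rewrite /dmx -diag_const_mx; congr diag_mx; apply/rowP => i; rewrite !mxE. Qed.

Lemma dmx0 : dmx (fun=> 0) = 0.
Proof. by rewrite dmx_cst -scalemx1 scale0r. Qed.

Lemma dblkM a b c d a' b' c' d' : dblk a b c d *m dblk a' b' c' d' =
  dblk (fun i => a i * a' i + b i * c' i) (fun i => a i * b' i + b i * d' i)
       (fun i => c i * a' i + d i * c' i) (fun i => c i * b' i + d i * d' i).
Proof. by rewrite /dblk mulmx_block !dmxM !dmxD. Qed.

Lemma dblkD a b c d a' b' c' d' : dblk a b c d + dblk a' b' c' d' =
  dblk (fun i => a i + a' i) (fun i => b i + b' i)
       (fun i => c i + c' i) (fun i => d i + d' i).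
Proof. by rewrite /dblk add_block_mx !dmxD. Qed.

Lemma dblkZ (k : R) a b c d : k *: dblk a b c d =
  dblk (fun i => k * a i) (fun i => k * b i)
       (fun i => k * c i) (fun i => k * d i).
Proof. by rewrite /dblk scale_block_mx !dmxZ. Qed.

Lemma dblk_tr a b c d : (dblk a b c d)^T = dblk a c b d.
Proof. by rewrite /dblk tr_block_mx !tr_diag_mx. Qed.

Lemma dblk1 : dblk (fun=> 1) (fun=> 0) (fun=> 0) (fun=> 1) = 1%:M.
Proof. by rewrite /dblk dmx0 !dmx_cst -scalar_mx_block. Qed.

Lemma eq_dblk a b c d a' b' c' d' :
  a =1 a' -> b =1 b' -> c =1 c' -> d =1 d' -> dblk a b c d = dblk a' b' c' d'.
Proof. by move=> /funext -> /funext -> /funext -> /funext ->. Qed.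

(** Elimination of the lower left block, which needs invertible [d i]. *)
Lemma det_dblk a b c d : (forall i, d i != 0) ->
  \det (dblk a b c d) = \prod_i (a i * d i - b i * c i).
Proof.
move=> d0.
have H : dblk a b c d *m
    dblk (fun=> 1) (fun=> 0) (fun i => - (c i / d i)) (fun=> 1)
  = dblk (fun i => (a i * d i - b i * c i) / d i) b (fun=> 0) d.
  rewrite dblkM; apply: eq_dblk => i; have := d0 i => ?; by field.
have : \det (dblk a b c d) * 1 = \prod_i (a i * d i - b i * c i).
  transitivity (\det (dblk a b c d) *
     \det (dblk (fun=> 1) (fun=> 0) (fun i => - (c i / d i)) (fun=> 1))).
    rewrite /dblk; congr (_ * _).
    by rewrite dmx0 det_lblock dmx_cst det1 mulr1.
  rewrite -det_mulmx H /dblk dmx0 det_ublock !det_diag.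
  rewrite -big_split /=; apply: eq_bigr => i _; rewrite !mxE.
  by rewrite divfK.
by rewrite mulr1.
Qed.

End diagonal_blocks.

(** * Spectrum of the discrete Laplacian *)

Section laplacian_spectrum.
Context {R : realType} (N : nat) (ds : R).
Hypothesis ds0 : 0 < ds.

Local Notation theta := (pi / N.+1%:R : R).

Definition sine_mx : 'M[R]_N := \matrix_(i, j) sin (i.+1%:R * (j.+1%:R * theta)).

Definition lap_eigen (j : 'I_N) : R := 2 / ds ^+ 2 * (1 - cos (j.+1%:R * theta)).

(** Extending a grid function by [f 0 = f N.+1 = 0] makes the boundary rows
    of the matrix look like the interior ones. *)
Lemma laplacian_mul (f : nat -> R) (i : 'I_N) : f 0 = 0 -> f N.+1 = 0 ->
  \sum_k laplacian N ds i k * f k.+1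
  = (f i - 2 * f i.+1 + f i.+2) / ds ^+ 2.
Proof.
move=> f0 fN.
have pick (g : nat -> R) (q : nat) : \sum_(k < N) (k == q :> nat)%:R * g k
    = if (q < N)%N then g q else 0.
  case: ltnP => [qN|Nq].
    rewrite (bigD1 (Ordinal qN)) //= eqxx mul1r big1 ?addr0// => k kq.
    by rewrite (_ : (k == q :> nat) = false) ?mul0r//; apply: contra_neqF kq => /eqP kq; apply: val_inj.
  rewrite big1// => k _; rewrite (_ : (k == q :> nat) = false) ?mul0r//.
  by apply/negbTE; rewrite neq_ltn (leq_trans (ltn_ord k)).
pose g k := f k.+1.
transitivity (- 2 / ds ^+ 2 * (\sum_(k < N) (k == i :> nat)%:R * g k)
   + 1 / ds ^+ 2 * (\sum_(k < N) (k == i.+1 :> nat)%:R * g k)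
   + 1 / ds ^+ 2 * (\sum_(k < N) (k.+1 == i :> nat)%:R * g k)).
  rewrite !mulr_sumr -!big_split /=; apply: eq_bigr => k _.
  rewrite /g !mxE (eq_sym (k : nat) i) (eq_sym (k : nat) i.+1) -val_eqE /=.
  case: (eqVneq (i : nat) k) => [ik|ik].
    have -> : (i.+1 == k) = false by apply/negbTE; rewrite ik neq_ltn ltnSn orbT.
    have -> : (k.+1 == i) = false by apply/negbTE; rewrite ik neq_ltn ltnSn orbT.
    by rewrite mulr1n mulr0n; ring.
  case: (eqVneq i.+1 (k : nat)) => [ik1|ik1] /=.
    have -> : (k.+1 == i) = false.
      by apply/negbTE; rewrite -ik1 neq_ltn (ltnW (ltnSn _)) orbT.
    by rewrite mulr1n mulr0n; ring.
  by case: eqP => _; rewrite ?mulr1n ?mulr0n; ring.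
rewrite !pick ltn_ord.
have -> : (if (i.+1 < N)%N then g i.+1 else 0) = f i.+2.
  case: ltnP => // Ni; rewrite (_ : i.+2 = N.+1) ?fN//.
  by congr S; apply/eqP; rewrite eqn_leq Ni andbT.
have -> : \sum_(k < N) (k.+1 == i :> nat)%:R * g k = f i.
  case: (nat_of_ord i) (ltn_ord i) => [|q] qN.
    by rewrite f0 big1// => k _; rewrite mul0r.
  under eq_bigr do rewrite eqSS.
  by rewrite pick (ltnW qN).
by rewrite /g; ring.
Qed.

Lemma sin_natpi (k : nat) : sin (k%:R * pi) = 0 :> R.
Proof.
elim: k => [|k IH]; first by rewrite mul0r sin0.
by rewrite -addn1 natrD mulrDl mul1r sinD IH sinpi mul0r mulr0 addr0.
Qed.

Lemma laplacian_sine : laplacian N ds *m sine_mx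
  = sine_mx *m dmx (fun j => - lap_eigen j).
Proof.
apply/matrixP => i j; rewrite mul_mx_diag !mxE.
pose f (k : nat) : R := sin (k%:R * (j.+1%:R * theta)).
transitivity (\sum_k laplacian N ds i k * f k.+1).
  by apply: eq_bigr => k _; rewrite [sine_mx _ _]mxE.
rewrite laplacian_mul; last 2 first.
- by rewrite /f mul0r sin0.
- rewrite /f (_ : _ * _ = j.+1%:R * pi); first by rewrite sin_natpi.
  by field.
rewrite /f /lap_eigen; set x := _ * theta.
have -> : i.+2%:R = i%:R + 2 :> R by rewrite -addn2 natrD.
have -> : i.+1%:R = i%:R + 1 :> R by rewrite -addn1 natrD.
have -> : (i%:R + 2) * x = (i%:R + 1) * x + x by ring.
have -> : i%:R * x = (i%:R + 1) * x - x by ring.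
by rewrite sinB sinD; ring.
Qed.

(** The angles lie in [0, pi], where the cosine is injective. *)
Lemma lap_eigen_inj : injective lap_eigen.
Proof.
move=> i j; rewrite /lap_eigen => /mulfI.
have -> : 2 / ds ^+ 2 != 0 by rewrite mulf_neq0// invr_neq0// expf_neq0// gt_eqF.
move=> /(_ isT) /addrI /oppr_inj.
have itv (k : 'I_N) : k.+1%:R * theta \in `[0, pi].
  rewrite in_itv /= mulr_ge0 ?divr_ge0 ?pi_ge0//= mulrA ler_pdivrMr// mulrC.
  by rewrite ler_pM2l ?pi_gt0// ler_nat ltnS ltnW.
move=> /(cos_inj (itv _) (itv _)) /mulIf.
have -> : theta != 0 by rewrite mulf_neq0// ?invr_neq0// gt_eqF ?pi_gt0.
by move=> /(_ isT)/eqP; rewrite eqr_nat eqSS => /eqP/val_inj.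
Qed.

Lemma laplacian_tr : (laplacian N ds)^T = laplacian N ds.
Proof. by apply/matrixP => i j; rewrite !mxE eq_sym orbC. Qed.

(** Eigenvectors of a symmetric matrix for distinct eigenvalues are orthogonal,
    so the trigonometric sums need not be evaluated. *)
Lemma sine_orthogonal : exists2 c : 'I_N -> R,
  forall j, 0 < c j & sine_mx^T *m sine_mx = dmx c.
Proof.
pose K := sine_mx^T *m sine_mx.
exists (fun j => K j j).
  move=> j; rewrite mxE; under eq_bigr do rewrite mxE -expr2.
  have N0 : (0 < N)%N by apply: leq_ltn_trans (ltn_ord j).
  rewrite (bigD1 (Ordinal N0))//= ltr_wpDr ?sumr_ge0// => [k _|].
    exact: sqr_ge0.
  rewrite exprn_even_gt0//= mxE /= mul1r gt_eqF// sin_gt0_pi//.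
  rewrite mulr_gt0 ?divr_gt0 ?pi_gt0//= mulrA ltr_pdivrMr// mulrC.
  by rewrite ltr_pM2l ?pi_gt0// ltr_nat ltnS.
have comm : dmx (fun j => - lap_eigen j) *m K = K *m dmx (fun j => - lap_eigen j).
  rewrite -[RHS]mulmxA -laplacian_sine mulmxA -[in RHS]laplacian_tr -trmx_mul.
  by rewrite laplacian_sine trmx_mul tr_diag_mx mulmxA.
rewrite -/K; move: K comm => K comm.
apply/matrixP => i j; rewrite /dmx !mxE; case: eqVneq => [->|ij]; rewrite ?mulr1n ?mulr0n//.
have := congr1 (fun A : 'M[R]_N => A i j) comm.
rewrite /= mul_diag_mx mul_mx_diag !mxE => H.
have : (lap_eigen i - lap_eigen j) * K i j = 0.
  by rewrite mulrBl [lap_eigen j * _]mulrC; move: H; lra.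
move/eqP; rewrite mulf_eq0 subr_eq0 => /orP[/eqP/lap_eigen_inj/eqP|/eqP//].
by rewrite (negbTE ij).
Qed.

(** If 0 <= cos y < 1 / 2, then cos (2 y) = 2 cos ^ 2 y - 1 < 0, although 2 y
    lies in [0, pi / 2]. *)
Lemma cos_ge_half (y : R) : 0 <= y <= pi / 4 -> 2^-1 <= cos y.
Proof.
move=> /andP[y0 ypi].
have pi0 := pi_gt0 R.
have cy0 : 0 <= cos y by apply: cos_ge0_pihalf; apply/andP; split; lra.
have c2 : 0 <= cos (y *+ 2).
  by apply: cos_ge0_pihalf; rewrite -mulr_natl; apply/andP; split; lra.
rewrite cos_mulr2n -mulr_natl in c2.
rewrite leNgt; apply/negP => cy.
have : cos y ^+ 2 < 2^-1 ^+ 2 by rewrite ltr_pXn2r ?nnegrE// invr_ge0.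
lra.
Qed.

Lemma sin_ge_half (y : R) : 0 <= y <= pi / 4 -> y / 2 <= sin y.
Proof.
move=> /andP[]; rewrite le_eqVlt => /orP[/eqP<-|y0 ypi]; first by rewrite mul0r sin0.
have [|c] := @MVT R sin cos 0 y y0 (fun x _ => is_derive_sin x).
  by apply: continuous_subspaceT; exact: continuous_sin.
rewrite in_itv /= => /andP[c0 cy]; rewrite sin0 !subr0 => ->.
rewrite mulrC ler_wpM2r ?(ltW y0)//; apply: cos_ge_half.
by rewrite ltW// (le_trans (ltW cy)).
Qed.

Lemma sin_ge_quarter (x : R) : 0 <= x <= pi / 2 -> x / 4 <= sin x.
Proof.
move=> /andP[x0 xpi].
have y0 : 0 <= x / 2 <= pi / 4 by apply/andP; split; lra.
have := cos_ge_half y0; have := sin_ge_half y0.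
rewrite [in sin x](_ : x = x / 2 + x / 2) ?sinD; last by field.
by nra.
Qed.

(** With X = (j + 1) pi / (N + 1), the eigenvalue is 4 sin ^ 2 (X / 2) / ds ^ 2,
    of the order of the continuous eigenvalue ((j + 1) pi / S) ^ 2. The linear
    lower bound on the sine and pi >= 2 give the constant. *)
Lemma lap_eigen_ge (S : R) (j : 'I_N) : 0 < S -> ds = S / N.+1%:R ->
  (j.+1%:R / (2 * S)) ^+ 2 <= lap_eigen j.
Proof.
move=> S0 dsE; rewrite /lap_eigen; set X := _ * theta.
have N0 : (0 : R) < N.+1%:R by rewrite ltr0Sn.
have X0 : 0 <= X by rewrite mulr_ge0 ?divr_ge0 ?pi_ge0.
have Xpi : X <= pi.
  rewrite /X mulrA ler_pdivrMr// mulrC.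
  by rewrite ler_pM2l ?pi_gt0// ler_nat ltnS ltnW.
have sX : X / 2 / 4 <= sin (X / 2) by apply: sin_ge_quarter; apply/andP; split; lra.
have cX : 1 - cos X = 2 * sin (X / 2) ^+ 2.
  rewrite [in cos X](_ : X = X / 2 + X / 2) ?cosD; last by field.
  by have := cos2Dsin2 (X / 2); lra.
have s2 : (X / 2 / 4) ^+ 2 <= sin (X / 2) ^+ 2.
  by rewrite ler_pXn2r ?nnegrE//; [lra|apply: le_trans sX; lra].
rewrite cX; apply: (@le_trans _ _ (2 / ds ^+ 2 * (2 * (X / 2 / 4) ^+ 2))).
  have -> : 2 / ds ^+ 2 * (2 * (X / 2 / 4) ^+ 2)
    = (j.+1%:R / (2 * S)) ^+ 2 * (pi / 2) ^+ 2.
    by rewrite dsE /X; field; rewrite !gt_eqF.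
  rewrite ler_peMr ?sqr_ge0// -[leLHS](expr1n _ 2) ler_pXn2r ?nnegrE ?divr_ge0 ?pi_ge0//.
  by have := pi_ge2 R; lra.
by rewrite ler_wpM2l ?ler_wpM2l// divr_ge0// sqr_ge0.
Qed.

End laplacian_spectrum.

(** * The integrator, mode by mode *)

Section exponential.
Context {R : realType}.

Lemma expmx_square0 k (X : 'M[R]_k) : X *m X = 0 -> expmx X = 1%:M + X.
Proof.
move=> X2; rewrite /expmx; apply: lim_near_cst; first exact: norm_hausdorff.
exists 2%N => // -[|[|n]]// _; rewrite /series /= big_nat_recl//= big_nat_recl//=.
rewrite big1_seq => [|i _]; last first.
  by rewrite !exprS mulrA -[X * X]/(X *m X) X2 mul0r scaler0.
by rewrite addr0 expr0 expr1 fact0 invr1 !scale1r.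
Qed.

End exponential.

Section rotation.
Context {R : realType}.
Implicit Types a b w : R.

(** First row of the m-th power of [a, b; - w b, a]. When a ^ 2 + w b ^ 2 = 1
    and a = cos phi, this is (cos (m phi), sin (m phi) / sqrt w). *)
Fixpoint rotation (a b w : R) (m : nat) : R * R :=
  if m is m'.+1 then
    let: (al, be) := rotation a b w m' in (al * a - w * be * b, al * b + be * a)
  else (1, 0).

Lemma rotation_invariant a b w m : a ^+ 2 + w * b ^+ 2 = 1 ->
  (rotation a b w m).1 ^+ 2 + w * (rotation a b w m).2 ^+ 2 = 1.
Proof.
move=> ab; elim: m => [|m] /=; first by rewrite expr0n mulr0 addr0 expr1n.
case: rotation => al be /= IH; rewrite -[RHS]mulr1 -{2}ab -IH; ring.
Qed.

(** The bound |sin (m phi)| <= m |sin phi|, by the addition formula. *)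
Lemma rotation_sin_le a b w m : 0 <= w -> a ^+ 2 + w * b ^+ 2 = 1 ->
  w * (rotation a b w m).2 ^+ 2 <= m%:R ^+ 2 * (w * b ^+ 2).
Proof.
move=> w0 ab.
set r := Num.sqrt w.
have r2 : w = r ^+ 2 by rewrite sqr_sqrtr.
have bound (x y : R) : x ^+ 2 + y ^+ 2 = 1 -> `|x| <= 1.
  move=> xy; rewrite -(@ler_pXn2r _ 2)// ?nnegrE//.
  by rewrite expr1n real_normK ?num_real// -xy lerDl sqr_ge0.
have r0 : 0 <= r by exact: sqrtr_ge0.
suff : `|r * (rotation a b w m).2| <= m%:R * `|r * b|.
  rewrite -(@ler_pXn2r _ 2)// ?nnegrE ?mulr_ge0//.
  by rewrite exprMn !real_normK ?num_real// !exprMn -r2.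
have inv k := rotation_invariant k ab.
elim: m => [|m] /=; first by rewrite mulr0 normr0 mul0r.
have := inv m; case: rotation => al be /= inv_m IH.
have -> : r * (al * b + be * a) = al * (r * b) + a * (r * be) by ring.
apply: (le_trans (ler_normD _ _)); rewrite -addn1 natrD mulrDl mul1r [leRHS]addrC.
apply: lerD.
  by rewrite normrM ler_piMl// (bound al (r * be))// exprMn -r2.
rewrite normrM (le_trans _ IH)// ler_piMl//.
by apply: (bound a (r * b)); rewrite exprMn -r2.
Qed.

End rotation.

Section diagonalisation.
Context {R : realType} (N : nat) (ds h : R).
Hypotheses (ds0 : 0 < ds) (h0 : 0 < h) (h1 : h <= 1).

Notation lam := (@lap_eigen R N ds).
Notation C := (matC N ds h).

(** Precision matrix of the Gibbs measure. *)
Definition energy_mx : 'M[R]_(N + N) :=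
  ds *: block_mx (1%:M - laplacian N ds) 0 0 1%:M.

Lemma energy_mxE (z : 'cV[R]_(N + N)) :
  ds * hamiltonian ds (usubmx z) (dsubmx z) = 2^-1 * qform energy_mx z.
Proof.
have sq k (x : 'cV[R]_k) : sqnorm2 x = (x^T *m x) 0 0.
  by rewrite mxE; apply: eq_bigr => i _; rewrite mxE expr2.
rewrite /hamiltonian !sq /qform /energy_mx -[z]vsubmxK !col_mxKu !col_mxKd.
set u := usubmx z; set p := dsubmx z.
rewrite -scalemxAr -scalemxAl [in RHS]mxE tr_col_mx mul_row_block mul_row_col.
rewrite !mulmx0 addr0 add0r mulmx1 mulmxBr mulmx1 mulmxBl [in RHS]mxE.
rewrite (_ : (u^T *m u - u^T *m laplacian N ds *m u) 0 0
  = (u^T *m u) 0 0 - (u^T *m laplacian N ds *m u) 0 0); first by ring.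
by rewrite [LHS]mxE [X in _ + X]mxE.
Qed.

(** The Cayley transform of h [0, 1; - lam, 0] is [c, s; - lam s, c], with
    c = [mode_c] and s = [mode_s]. The two half kicks change the diagonal into
    [mode_a] and the lower left entry into - [mode_w] * s. *)
Definition mode_c j : R := (1 - h ^+ 2 * lam j / 4) / (1 + h ^+ 2 * lam j / 4).
Definition mode_s j : R := h / (1 + h ^+ 2 * lam j / 4).
Definition mode_a j : R := mode_c j - h / 2 * mode_s j.
Definition mode_w j : R := (1 - h ^+ 2 / 4) * (1 + lam j).

Lemma lap_eigen_ge0 j : 0 <= lam j.
Proof. by rewrite mulr_ge0 ?divr_ge0 ?sqr_ge0// subr_ge0 cos_le1. Qed.

Lemma mode_den_gt0 j : 0 < 1 + h ^+ 2 * lam j / 4.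
Proof. by rewrite ltr_pwDl// divr_ge0// mulr_ge0 ?sqr_ge0 ?lap_eigen_ge0. Qed.

Lemma mode_w_gt0 j : 0 < mode_w j.
Proof.
have h2 : h ^+ 2 <= 1 by rewrite expr_le1// ltW.
apply: mulr_gt0; first lra.
by rewrite ltr_pwDl// lap_eigen_ge0.
Qed.

(** Each mode of the integrator has determinant 1. Together with its equal
    diagonal entries this makes it a rotation for p ^ 2 + [mode_w] q ^ 2. *)
Lemma mode_unit j : mode_a j ^+ 2 + mode_w j * mode_s j ^+ 2 = 1.
Proof.
rewrite /mode_a /mode_w /mode_c /mode_s; field.
have := mode_den_gt0 j; move: (lam j) => l; lra.
Qed.

Definition modes_mx : 'M[R]_(N + N) := block_mx (sine_mx N) 0 0 (sine_mx N).

Lemma modes_mx_dblk a b c d : modes_mx *m dblk a b c d =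
  block_mx (sine_mx N *m dmx a) (sine_mx N *m dmx b)
           (sine_mx N *m dmx c) (sine_mx N *m dmx d).
Proof. by rewrite /modes_mx /dblk mulmx_block !mul0mx !addr0 !add0r. Qed.

(** The Gram matrix of the sine vectors has nonzero determinant. *)
Lemma modes_mx_unit : modes_mx \in unitmx.
Proof.
have [c c0 Hc] := sine_orthogonal N ds0.
have V0 : \det (sine_mx N) != 0 :> R.
  have : \det ((sine_mx N)^T *m sine_mx N) != 0 :> R.
    rewrite Hc det_diag; apply/prodf_neq0 => i _.
    by rewrite mxE gt_eqF.
  by rewrite det_mulmx mulf_eq0 negb_or => /andP[_].
by rewrite unitmxE unitfE /modes_mx det_ublock mulf_neq0.
Qed.

Lemma matA_modes : matA N ds *m modes_mx =
  modes_mx *m dblk (fun=> 0) (fun=> 1) (fun j => - lam j) (fun=> 0).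
Proof.
rewrite modes_mx_dblk dmx0 dmx_cst !mulmx0 mulmx1 -laplacian_sine /matA /modes_mx.
by rewrite mulmx_block !mul0mx !mulmx0 !mul1mx !addr0 !add0r.
Qed.

Lemma kick_modes : expmx ((2^-1 * h) *: matB N) *m modes_mx =
  modes_mx *m dblk (fun=> 1) (fun=> 0) (fun=> - (h / 2)) (fun=> 1).
Proof.
rewrite expmx_square0; last first.
  rewrite -scalemxAl -scalemxAr /matB mulmx_block !mul0mx !mulmx0 !addr0.
  by rewrite /block_mx !row_mx0 col_mx0 !scaler0.
rewrite mulmxDl mul1mx -scalemxAl modes_mx_dblk dmx0 !dmx_cst mulmx0 mulmx1.
rewrite /matB /modes_mx mulmx_block !mul0mx !mulmx0 !addr0 scale_block_mx !scaler0.
rewrite add_block_mx !addr0 add0r mul_mx_scalar mulNmx mul1mx scalerN -scaleNr.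
by congr block_mx; congr (_ *: _); ring.
Qed.

(** The inverse in the Cayley transform exists because, in the mode j,
    I - h A / 2 has determinant 1 + h ^ 2 lam_j / 4. *)
Lemma cay_modes : caymx (h *: matA N ds) *m modes_mx =
  modes_mx *m dblk mode_c mode_s (fun j => - lam j * mode_s j) mode_c.
Proof.
have A_modes (k : R) : (1%:M + k *: (h *: matA N ds)) *m modes_mx =
    modes_mx *m dblk (fun=> 1) (fun=> k * h) (fun j => k * (h * - lam j)) (fun=> 1).
  rewrite mulmxDl mul1mx -!scalemxAl matA_modes scalemxAr [k *: _]scalemxAr.
  rewrite -{1}[modes_mx]mulmx1 -mulmxDr !dblkZ -dblk1 dblkD; congr mulmx.
  by apply: eq_dblk => j; ring.
rewrite /caymx.
have -> : 1%:M - 2^-1 *: (h *: matA N ds) = 1%:M + (- 2^-1) *: (h *: matA N ds).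
  by rewrite scaleNr.
set A := _ + _.
have A_unit : A \in unitmx.
  have : A *m modes_mx \in unitmx.
    rewrite A_modes unitmx_mul modes_mx_unit unitmxE unitfE det_dblk ?oner_neq0//.
    apply/prodf_neq0 => j _; rewrite gt_eqF//; have := mode_den_gt0 j.
    by congr (0 < _); field.
  by rewrite unitmx_mul => /andP[].
rewrite -mulmxA A_modes; apply: (canLR (mulKmx A_unit)).
rewrite mulmxA A_modes -mulmxA dblkM; congr mulmx.
by apply: eq_dblk => j; have := mode_den_gt0 j;
  rewrite /mode_c /mode_s; move: (lam j) => l l0; field; lra.
Qed.

Lemma matC_modes : C *m modes_mx =
  modes_mx *m dblk mode_a mode_s (fun j => - (mode_w j * mode_s j)) mode_a.
Proof.
rewrite /matC -mulmxA kick_modes mulmxA -[_ *m modes_mx]mulmxA cay_modes mulmxA kick_modes.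
rewrite -!mulmxA !dblkM; congr mulmx.
by apply: eq_dblk => j; have := mode_den_gt0 j;
  rewrite /mode_a /mode_w /mode_c /mode_s; move: (lam j) => l l0; field; lra.
Qed.

Variable m : nat.

Notation rot j := (rotation (mode_a j) (mode_s j) (mode_w j) m).

Lemma matC_exp_modes : C ^+ m *m modes_mx = modes_mx *m
  dblk (fun j => (rot j).1) (fun j => (rot j).2)
       (fun j => - (mode_w j * (rot j).2)) (fun j => (rot j).1).
Proof.
elim: m => [|k IH].
  rewrite expr0 mul1mx -[LHS]mulmx1 -dblk1; congr mulmx.
  by apply: eq_dblk => j //=; rewrite mulr0 oppr0.
rewrite exprSr -mulmxE -mulmxA matC_modes mulmxA IH -mulmxA dblkM; congr mulmx.
by apply: eq_dblk => j /=; case: rotation => al be /=; ring.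
Qed.

Lemma mode_rotation_unit j : (rot j).1 ^+ 2 + mode_w j * (rot j).2 ^+ 2 = 1.
Proof. by rewrite rotation_invariant// mode_unit. Qed.

(** Precision matrix of the Gaussian z |-> exp (- ds * H (C^m z)). *)
Definition energy_pullback := (C ^+ m)^T *m energy_mx *m C ^+ m.

Lemma energy_modes (c : 'I_N -> R) : (sine_mx N)^T *m sine_mx N = dmx c ->
  modes_mx^T *m energy_mx *m modes_mx =
  dblk (fun j => ds * c j * (1 + lam j)) (fun=> 0) (fun=> 0) (fun j => ds * c j).
Proof.
move=> Hc; rewrite /energy_mx -scalemxAr -scalemxAl /modes_mx tr_block_mx !trmx0.
rewrite !mulmx_block !(mul0mx, mulmx0, addr0, add0r) mulmx1 Hc.
rewrite mulmxBr mulmx1 mulmxBl Hc -mulmxA laplacian_sine mulmxA Hc dmxM.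
rewrite -scaleN1r dmxZ dmxD -dmx0 scale_block_mx !dmxZ.
by apply: eq_dblk => j; ring.
Qed.

Lemma pullback_modes (c : 'I_N -> R) : (sine_mx N)^T *m sine_mx N = dmx c ->
  modes_mx^T *m energy_pullback *m modes_mx =
  dblk (fun j => ds * c j * ((rot j).1 ^+ 2 * (1 + lam j) + mode_w j ^+ 2 * (rot j).2 ^+ 2))
       (fun j => ds * c j * ((rot j).1 * (rot j).2 * (1 + lam j - mode_w j)))
       (fun j => ds * c j * ((rot j).1 * (rot j).2 * (1 + lam j - mode_w j)))
       (fun j => ds * c j * ((rot j).1 ^+ 2 + (1 + lam j) * (rot j).2 ^+ 2)).
Proof.
move=> /energy_modes Hc; rewrite /energy_pullback.
transitivity ((C ^+ m *m modes_mx)^T *m energy_mx *m (C ^+ m *m modes_mx)).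
  by rewrite trmx_mul !mulmxA.
rewrite matC_exp_modes trmx_mul -!mulmxA [energy_mx *m (_ *m _)]mulmxA.
rewrite [modes_mx^T *m (_ *m _)]mulmxA [modes_mx^T *m (_ *m _)]mulmxA Hc dblk_tr !dblkM.
by apply: eq_dblk => j; ring.
Qed.

Lemma det_modes_congr (P : 'M[R]_(N + N)) :
  \det (modes_mx^T *m P *m modes_mx) = \det modes_mx ^+ 2 * \det P.
Proof. by rewrite !det_mulmx det_tr; ring. Qed.

(** In the mode j the quotient of the two determinants is the square of
    a ^ 2 + w b ^ 2 = 1. Computing it for [energy_pullback] rather than for C^m
    itself keeps the lower right entries nonzero, which [det_dblk] requires;
    the entries cos (m phi_j) of C^m may vanish. *)
Lemma det_pullback : \det energy_pullback = \det energy_mx.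
Proof.
have [c c0 Hc] := sine_orthogonal N ds0.
have V0 : \det modes_mx ^+ 2 != 0 by rewrite expf_neq0// -unitfE -unitmxE modes_mx_unit.
have K0 j : ds * c j != 0 by rewrite gt_eqF// mulr_gt0.
apply: (mulfI V0); rewrite -!det_modes_congr (energy_modes Hc) (pullback_modes Hc).
rewrite !det_dblk//; last first.
  move=> j; rewrite mulf_neq0// gt_eqF//.
  have w0 := mode_w_gt0 j; have := mode_rotation_unit j; have := lap_eigen_ge0 j.
  move: (lam j) (mode_w j) w0 (rot j) => l w w0 [x y] /= l0 xy.
  have := sqr_ge0 x; have := sqr_ge0 y; rewrite le_eqVlt => /orP[/eqP y0|y0 x0].
    by move: xy; rewrite -y0; lra.
  by rewrite ltr_wpDl// mulr_gt0//; lra.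
apply: eq_bigr => j _; rewrite mulr0 subr0.
transitivity ((ds * c j) ^+ 2 * (1 + lam j) *
  ((rot j).1 ^+ 2 + mode_w j * (rot j).2 ^+ 2) ^+ 2); first ring.
by rewrite mode_rotation_unit; ring.
Qed.

(** The first-order effects of the energy error h ^ 2 / 4 cancel between the
    position and the momentum, which leaves a correction of order h ^ 4. *)
Lemma det_midpoint :
  \det (2^-1 *: (energy_mx + energy_pullback)) =
  \det energy_mx * \prod_j
    (1 + h ^+ 4 / (64 * (1 - h ^+ 2 / 4)) * (mode_w j * (rot j).2 ^+ 2)).
Proof.
have [c c0 Hc] := sine_orthogonal N ds0.
have V0 : \det modes_mx ^+ 2 != 0 by rewrite expf_neq0// -unitfE -unitmxE modes_mx_unit.
have K0 j : ds * c j != 0 by rewrite gt_eqF// mulr_gt0.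
apply: (mulfI V0); rewrite mulrA -!det_modes_congr -scalemxAr -scalemxAl.
rewrite mulmxDr mulmxDl (energy_modes Hc) (pullback_modes Hc) dblkD dblkZ.
rewrite !det_dblk//; last first.
  move=> j; rewrite mulf_neq0// gt_eqF//.
  have C0 : 0 < ds * c j by rewrite mulr_gt0.
  by rewrite ltr_pwDl// mulr_ge0 ?(ltW C0)// addr_ge0 ?sqr_ge0// mulr_ge0 ?sqr_ge0// addr_ge0 ?lap_eigen_ge0.
rewrite -big_split /=; apply: eq_bigr => j _; rewrite mulr0 subr0.
have hk : 1 - h ^+ 2 / 4 != 0.
  have : h ^+ 2 <= 1 by rewrite expr_le1// ltW.
  by move=> ?; rewrite gt_eqF//; lra.
have x2 : (rot j).1 ^+ 2 = 1 - mode_w j * (rot j).2 ^+ 2 by rewrite -(mode_rotation_unit j) addrK.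
transitivity ((ds * c j) ^+ 2 / 4 *
 ((1 + lam j + ((rot j).1 ^+ 2 * (1 + lam j) + mode_w j ^+ 2 * (rot j).2 ^+ 2)) *
  (1 + ((rot j).1 ^+ 2 + (1 + lam j) * (rot j).2 ^+ 2)) -
  (rot j).1 ^+ 2 * (rot j).2 ^+ 2 * (1 + lam j - mode_w j) ^+ 2)); first by field.
rewrite x2 /mode_w; move: (rot j).2 (lam j) (ds * c j) => y l K; field.
by move: hk; apply: contra => /eqP hk; apply/eqP; lra.
Qed.

(** In the basis of modes the quadratic form is diagonal with entries
    ds c_j (1 + lam_j) and ds c_j. *)
Lemma energy_posdef : posdef energy_mx.
Proof.
have [c c0 Hc] := sine_orthogonal N ds0.
have K0 j : 0 < ds * c j by rewrite mulr_gt0.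
split.
  by rewrite /energy_mx linearZ /= tr_block_mx !trmx0 linearB /= laplacian_tr !trmx1.
move=> x x0; have [y xE] : exists y, x = modes_mx *m y.
  by exists (invmx modes_mx *m x); rewrite mulKVmx// modes_mx_unit.
have y0 : y != 0 by apply: contra_neq x0 => y0; rewrite xE y0 mulmx0.
rewrite /qform xE trmx_mul -!mulmxA [energy_mx *m (_ *m _)]mulmxA.
rewrite [modes_mx^T *m (_ *m _)]mulmxA [modes_mx^T *m (_ *m _)]mulmxA (energy_modes Hc).
have -> : dblk (fun j => ds * c j * (1 + lam j)) (fun=> 0) (fun=> 0) (fun j => ds * c j)
  = diag_mx (row_mx (\row_j (ds * c j * (1 + lam j))) (\row_j (ds * c j))).
  by rewrite diag_mx_row /dblk dmx0.
rewrite mul_diag_mx mxE.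
have [i yi] : exists i, y i 0 != 0.
  apply/existsP; apply: contraNT y0; rewrite negb_exists => /forallP y0.
  by apply/eqP/colP => i; have := y0 i; rewrite negbK [RHS]mxE => /eqP.
have pos k : 0 < (row_mx (\row_j (ds * c j * (1 + lam j))) (\row_j (ds * c j))) 0 k.
  case: (split_ordP k) => j ->; first last; rewrite ?row_mxEl ?row_mxEr mxE //.
  by apply: mulr_gt0; rewrite // ltr_pwDl ?lap_eigen_ge0.
move: (row_mx _ _) pos => r pos.
rewrite (bigD1 i)//= ltr_wpDr//; last first.
  rewrite !mxE mulrCA mulr_gt0// -expr2.
  by rewrite exprn_even_gt0.
apply: sumr_ge0 => k _; rewrite !mxE mulrCA mulr_ge0 ?(ltW (pos k))//.
by rewrite -expr2 sqr_ge0.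
Qed.

(** The power of C is invertible since [det_pullback] gives a nonzero
    determinant to a product in which it is a factor. *)
Lemma pullback_posdef : posdef energy_pullback.
Proof.
have [ET Epos] := energy_posdef; split.
  by rewrite /energy_pullback !trmx_mul trmxK ET mulmxA.
have [detE _] := gaussian_integral energy_posdef.
have C_unit : C ^+ m \in unitmx.
  have : \det energy_pullback != 0 by rewrite det_pullback gt_eqF.
  by rewrite !det_mulmx !mulf_eq0 !negb_or unitmxE unitfE => /andP[].
move=> x x0.
have -> : qform energy_pullback x = qform energy_mx (C ^+ m *m x).
  by rewrite /qform /energy_pullback trmx_mul !mulmxA.
apply: Epos; apply: contra_neq x0 => Cx.
by rewrite -[x](mulKmx C_unit) Cx mulmx0.
Qed.

End diagonalisation.

(** * Summation over the modes *)

Section mode_sums.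
Context {R : realType}.

(** At most about A terms are cut off at 1, and the tail beyond A is bounded by
    the telescoping series of A ^ 2 / (k (k + 1)). *)
Lemma sum_min_inv_sqr (A : R) (k : nat) : 0 < A ->
  \sum_(j < k) Num.min 1 (A ^+ 2 / j.+1%:R ^+ 2) <= 2 * A + 1.
Proof.
move=> A0.
(* the first claim is for the range k < A, the second one for the tail *)
suff [H1 H2] : \sum_(j < k) Num.min 1 (A ^+ 2 / j.+1%:R ^+ 2) <= k%:R /\
   (A <= k%:R -> \sum_(j < k) Num.min 1 (A ^+ 2 / j.+1%:R ^+ 2)
      <= 2 * A + 1 - A ^+ 2 / k%:R).
  have [Ak|kA] := leP A k%:R; last by lra.
  apply: (le_trans (H2 Ak)); rewrite gerBl divr_ge0 ?sqr_ge0//.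
elim: k => [|k [IH1 IH2]].
  rewrite big_ord0; split=> // A0'; lra.
rewrite big_ord_recr /=; set sg := \sum_(_ < _) _ in IH1 IH2 *.
set t := Num.min _ _.
have t1 : t <= 1 by rewrite ge_min lexx.
have t2 : t <= A ^+ 2 / k.+1%:R ^+ 2 by rewrite ge_min lexx orbT.
have kS : k.+1%:R = k%:R + 1 :> R by rewrite -addn1 natrD.
have k0 : (0 : R) <= k%:R by [].
rewrite kS in t2 *; split=> [|AkS]; first lra.
have [Ak|kA] := leP A k%:R.
  have {}k0 : (0 : R) < k%:R by exact: lt_le_trans Ak.
  have := IH2 Ak.
  suff : A ^+ 2 / (k%:R + 1) ^+ 2 <= A ^+ 2 / k%:R - A ^+ 2 / (k%:R + 1) by lra.
  have -> : A ^+ 2 / k%:R - A ^+ 2 / (k%:R + 1) = A ^+ 2 / (k%:R * (k%:R + 1)).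
    by field; rewrite !gt_eqF//; lra.
  rewrite ler_wpM2l ?sqr_ge0// lef_pV2 ?posrE ?mulr_gt0 ?exprn_gt0//; nra.
have : A ^+ 2 / (k%:R + 1) <= A.
  by rewrite ler_pdivrMr; nra.
lra.
Qed.

End mode_sums.

(** * Convergence of the acceptance probability *)

Section error_estimate.
Context {R : realType} (N : nat) (T S h : R).
Hypotheses (T0 : 0 < T) (S0 : 0 < S) (h0 : 0 < h) (h1 : h <= 1).
Variable m : nat.
Hypothesis mT : m%:R <= T / h.

Let ds : R := S / N.+1%:R.

Let ds0 : 0 < ds. Proof. by rewrite divr_gt0. Qed.

Notation sin2 j :=
  (mode_w ds h j * (rotation (mode_a ds h j) (mode_s ds h j) (mode_w ds h j) m).2 ^+ 2).

(** The bound 1 is for low modes, the other one for high modes. It combines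
    sin ^ 2 (m phi) <= m ^ 2 sin ^ 2 phi with m <= T / h, with
    sin ^ 2 phi <= 16 / (h ^ 2 (1 + lam)) and with the quadratic growth of
    lam. *)
Lemma sin2_le (j : 'I_N) :
  sin2 j <= Num.min 1 ((8 * T * S / h ^+ 2) ^+ 2 / j.+1%:R ^+ 2).
Proof.
have w0 := mode_w_gt0 ds h0 h1 j.
rewrite le_min; apply/andP; split.
  by rewrite -(mode_rotation_unit ds h m j) lerDr sqr_ge0.
apply: (le_trans (rotation_sin_le m (ltW w0) (mode_unit ds h j))).
have l0 := lap_eigen_ge0 ds j.
have lS := lap_eigen_ge j S0 (erefl ds).
rewrite /mode_w /mode_s; set l := lap_eigen ds j in l0 lS *.
have j0 : (0 : R) < j.+1%:R by [].
have h2 : h ^+ 2 <= 1 by rewrite expr_le1// ltW.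
have h20 : 0 < h ^+ 2 by rewrite exprn_gt0.
have D0 : 0 < 1 + h ^+ 2 * l / 4 by nra.
have step1 : (1 - h ^+ 2 / 4) * (1 + l) * (h / (1 + h ^+ 2 * l / 4)) ^+ 2
    <= 16 / (h ^+ 2 * (1 + l)).
  have -> : (1 - h ^+ 2 / 4) * (1 + l) * (h / (1 + h ^+ 2 * l / 4)) ^+ 2 =
     (1 - h ^+ 2 / 4) * ((1 + l) * h ^+ 2 / (1 + h ^+ 2 * l / 4) ^+ 2).
    by field; lra.
  have -> : 16 / (h ^+ 2 * (1 + l)) = (1 + l) * h ^+ 2 / (h ^+ 2 * (1 + l) / 4) ^+ 2.
    by field; rewrite !gt_eqF//; lra.
  rewrite -[leRHS]mul1r ler_pM//.
  - lra.
  - by rewrite divr_ge0 ?sqr_ge0// mulr_ge0 ?sqr_ge0//; lra.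
  - lra.
  rewrite ler_wpM2l//; first by rewrite mulr_ge0 ?sqr_ge0//; lra.
  rewrite lef_pV2 ?posrE ?exprn_gt0 ?divr_gt0 ?mulr_gt0//; last lra.
  rewrite ler_pXn2r ?nnegrE ?(ltW D0)//; first lra.
  by rewrite divr_ge0// mulr_ge0 ?(ltW h20)//; lra.
have step2 : 16 / (h ^+ 2 * (1 + l)) <= 16 / (h ^+ 2 * (j.+1%:R / (2 * S)) ^+ 2).
  rewrite ler_wpM2l// lef_pV2 ?posrE.
  - by rewrite ler_wpM2l ?(ltW h20)//; lra.
  - by rewrite mulr_gt0//; lra.
  - by rewrite mulr_gt0// exprn_gt0// divr_gt0// mulr_gt0.
have step3 : m%:R ^+ 2 <= (T / h) ^+ 2.
  by rewrite ler_pXn2r ?nnegrE// divr_ge0// ltW.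
apply: (@le_trans _ _ ((T / h) ^+ 2 * (16 / (h ^+ 2 * (j.+1%:R / (2 * S)) ^+ 2)))).
  rewrite ler_pM ?sqr_ge0//; last exact: le_trans step2.
  by rewrite mulr_ge0 ?sqr_ge0// (ltW w0).
rewrite le_eqVlt; apply/orP; left; apply/eqP; field.
by rewrite !gt_eqF.
Qed.

Lemma prod_le_expR (I : finType) (f : I -> R) : (forall i, 0 <= f i) ->
  \prod_i (1 + f i) <= expR (\sum_i f i).
Proof.
move=> f0; rewrite expR_sum; apply: ler_prod => i _.
by rewrite expR_ge1Dx addr_ge0.
Qed.

(** The affinity is prod_j (1 + eta sin ^ 2 (m phi_j)) ^ (- 1 / 2), which is at
    least 1 - eta / 2 * sum_j sin ^ 2 (m phi_j) as 1 + x <= exp x. The sum has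
    order h ^ -2 and eta order h ^ 4. *)
Lemma overlap_ge : 1 - (T * S + 1) * h ^+ 2 <=
  Num.sqrt (\det (energy_mx N ds) /
    \det (2^-1 *: (energy_mx N ds + energy_pullback N ds h m))).
Proof.
have [detE _] := gaussian_integral (energy_posdef N ds0).
rewrite det_midpoint//.
set eta := h ^+ 4 / _.
have h2 : h ^+ 2 <= 1 by rewrite expr_le1// ltW.
have h20 : 0 < h ^+ 2 by rewrite exprn_gt0.
have eta0 : 0 <= eta by rewrite divr_ge0 ?exprn_ge0 ?(ltW h0)//; lra.
have eta1 : eta <= h ^+ 4 / 32.
  rewrite ler_wpM2l ?exprn_ge0 ?(ltW h0)// lef_pV2 ?posrE; lra.
set P := \prod_j _.
have P0 : 0 < P.
  apply: prodr_gt0 => j _; rewrite ltr_pwDl// mulr_ge0//.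
  by rewrite mulr_ge0 ?sqr_ge0// ltW// mode_w_gt0.
have -> : \det (energy_mx N ds) / (\det (energy_mx N ds) * P) = P^-1.
  by field; rewrite !gt_eqF.
pose A := 8 * T * S / h ^+ 2.
have A0 : 0 < A by rewrite divr_gt0// !mulr_gt0.
have sum_le : \sum_(j < N) eta * sin2 j <= eta * (2 * A + 1).
  rewrite -mulr_sumr ler_wpM2l//.
  apply: le_trans (sum_min_inv_sqr N A0).
  by apply: ler_sum => j _; exact: sin2_le.
have Ple : P <= expR (eta * (2 * A + 1)).
  apply: (@le_trans _ _ (expR (\sum_(j < N) eta * sin2 j))); last by rewrite ler_expR.
  apply: prod_le_expR => j; rewrite mulr_ge0//.
  by rewrite mulr_ge0 ?sqr_ge0// ltW// mode_w_gt0.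
apply: (@le_trans _ _ (expR (- (2^-1 * (eta * (2 * A + 1)))))); last first.
  rewrite -[leLHS]ger0_norm ?expR_ge0// -sqrtr_sqr ler_wsqrtr//.
  rewrite -expRM_natl -[leLHS]invrK lef_pV2 ?posrE ?invr_gt0 ?expR_gt0//.
  rewrite -expRN; apply: (le_trans Ple); rewrite ler_expR.
  lra.
apply: le_trans (expR_ge1Dx _).
rewrite lerD2l lerN2.
apply: (@le_trans _ _ (2^-1 * (h ^+ 4 / 32 * (2 * A + 1)))).
  by rewrite ler_wpM2l// ler_wpM2r//; lra.
have -> : 2^-1 * (h ^+ 4 / 32 * (2 * A + 1)) = T * S * h ^+ 2 / 4 + h ^+ 2 * h ^+ 2 / 64.
  by rewrite /A; field; rewrite gt_eqF.
have : 0 <= T * S by rewrite mulr_ge0 ?ltW.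
nra.
Qed.

Lemma gibbs_weightE z : gibbs_weight (N := N) ds (usubmx z) (dsubmx z)
  = gauss (energy_mx N ds) z.
Proof. by rewrite /gibbs_weight energy_mxE. Qed.

Lemma acceptance_weightE z :
  acceptance (N := N) ds h m (usubmx z) (dsubmx z)
    * gibbs_weight ds (usubmx z) (dsubmx z)
  = Num.min (gauss (energy_mx N ds) z) (gauss (energy_pullback N ds h m) z).
Proof.
rewrite gibbs_weightE /acceptance /proposal vsubmxK.
set y := matC N ds h ^+ m *m z.
have -> : gauss (energy_pullback N ds h m) z = gauss (energy_mx N ds) y.
  by rewrite /gauss /qform /energy_pullback /y trmx_mul !mulmxA.
rewrite mulrBr !energy_mxE minr_pMl ?expR_ge0// mul1r /gauss -expRD.
by congr (Num.min _ (expR _)); ring.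
Qed.

(** Since 1 - rho is O(h ^ 2), the free parameter of [gaussian_overlap] is taken
    to be h, so that both error terms are O(h). *)
Lemma gibbs_expectation_bounds :
  1 - ((T * S + 1) / 2 + 1) * h
  <= gibbs_expectation (N := N) ds (acceptance ds h m) <= 1.
Proof.
rewrite /gibbs_expectation /phase_integral.
set num := (X in _ <= X / _ <= _); set den := (X in _ <= _ / X <= _).
have -> : num = \int[lebesgue_tuple (N + N)]_t
    Num.min (gauss (energy_mx N ds) (col_of_tuple t))
      (gauss (energy_pullback N ds h m) (col_of_tuple t)).
  by apply: eq_Rintegral => t _; exact: acceptance_weightE.
have -> : den = \int[lebesgue_tuple (N + N)]_t
    gauss (energy_mx N ds) (col_of_tuple t).
  by apply: eq_Rintegral => t _; exact: gibbs_weightE.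
have := gaussian_overlap (energy_posdef N ds0)
  (pullback_posdef N ds0 h0 h1 m) (det_pullback N ds0 h0 h1 m) h0 overlap_ge _ h1.
have K0 : 0 <= (T * S + 1) * h ^+ 2.
  by rewrite mulr_ge0 ?sqr_ge0// addr_ge0// mulr_ge0 ?ltW.
have rho1 : 1 - (T * S + 1) * h ^+ 2 <= 1 by lra.
move=> /(_ rho1) /andP[lb ->]; rewrite andbT; apply: le_trans lb.
rewrite le_eqVlt; apply/orP; left; apply/eqP; field.
by rewrite gt_eqF.
Qed.

End error_estimate.

Unset Implicit Arguments.

Theorem proposition3p21 (R : realType) (T S : R) (hT : 0 < T) (hS : 0 < S) :
  (fun n : nat =>
     let ds : R := S / n%:R in
     let dt : R := ds `^ (1 / 4) in
     let m : nat := Num.truncn (T / dt) in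
     gibbs_expectation (N := n.-1) ds (acceptance ds dt m)) @ \oo --> (1 : R).
Proof.
(* for n = N + 1 the number of interior grid points n - 1 is N *)
rewrite -cvg_shiftS /=.
have ds_gt0 (N : nat) : 0 < S / N.+1%:R by rewrite divr_gt0.
have ds_cvg : S / n.+1%:R @[n --> \oo] --> (0 : R).
  by rewrite -[X in _ --> X](mulr0 S); apply: cvgMr; exact: cvg_harmonic.
have dt_cvg : (S / n.+1%:R) `^ (1 / 4) @[n --> \oo] --> (0 : R).
  have /cvg_at_rightP := @powR_cvg0 R (1 / 4) ltac:(lra).
  by apply; split.
apply: (@squeeze_cvgr _ _ _ _
  (fun n => 1 - ((T * S + 1) / 2 + 1) * (S / n.+1%:R) `^ (1 / 4)) (fun=> 1)).
- have dt1 : \forall n \near \oo, (S / n.+1%:R) `^ (1 / 4) <= 1 :> R.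
    move/cvgr_le : dt_cvg; apply; exact: ltr01.
  near=> N.
  have dt0 : 0 < (S / N.+1%:R) `^ (1 / 4) by rewrite powR_gt0.
  apply: gibbs_expectation_bounds => //; first by near: N.
  by rewrite truncn_le divr_ge0 ?ltW.
- rewrite -[X in _ --> X]subr0; apply: cvgB; first exact: cvg_cst.
  by rewrite -[X in _ --> X](mulr0 ((T * S + 1) / 2 + 1)); exact: cvgMr.
- exact: cvg_cst.
Unshelve. all: by end_near.
Qed.
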